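(* Let $n$ be a positive integer. For an ASM $(a_{i,j})_{1\le i,j\le n}\in\mathcal{A}_n$ define a matrix $(h_{i,j})_{0\le i,j\le n}$ by $$h_{i,j}:=i+j-2\sum_{1\le k\le i}\ \sum_{1\le l\le j}a_{k,l}\qquad(0\le i,j\le n).$$ Then this assignment is a bijection from $\mathcal{A}_n$ to $\mathcal{H}_n$, and its inverse is given by $$a_{i,j}:=-\tfrac12\bigl(h_{i-1,j-1}-h_{i-1,j}+h_{i,j}-h_{i,j-1}\bigr)\qquad(1\le i,j\le n).$$
   Context: An alternating sign matrix (ASM) of size $n$ is a matrix $(a_{i,j})_{1\le i,j\le n}$ with $a_{i,j}\in\{0,1,-1\}$, with all partial sums $\sum_{j=1}^{k}a_{i,j}$ and $\sum_{i=1}^{k}a_{i,j}$ in $\{0,1\}$ for $1\le k\le n$, and with every full row sum and full column sum equal to $1$. $\mathcal{A}_n$ is the set of ASMs of size $n$. A height function of degree $n$ is an $(n+1)\times(n+1)$ matrix $(h_{i,j})_{0\le i,j\le n}$ such that $|h_{i+1,j}-h_{i,j}|=1$ for $0\le i<n$, $0\le j\le n$; $|h_{i,j+1}-h_{i,j}|=1$ for $0\le i\le n$, $0\le j<n$; and $h_{i,0}=h_{0,i}=h_{n-i,n}=h_{n,n-i}=i$ for $0\le i\le n$. $\mathcal{H}_n$ is the set of all height functions of degree $n$. *)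

(* Defs.v *)
From mathcomp Require Import all_boot all_order all_algebra.
From mathcomp Require Import boolp classical_sets functions.

Set Implicit Arguments.
Unset Strict Implicit.
Unset Printing Implicit Defensive.

Import Order.TTheory GRing.Theory Num.Theory.

Local Open Scope classical_set_scope.
Local Open Scope ring_scope.

(* Matrices have rational entries, so that the factor 1/2 in [asm_of_height]
   is a genuine division. The defining conditions force the entries of members
   of [ASM n] and [height_function n] to be integers.

   Rows and columns of an n x n matrix are numbered from 0: the ordinal i
   stands for the index i + 1 of the usual 1-based convention. Height functions
   are numbered from 0 to n, and need no shift. *)

Definition ASM (n : nat) : set 'M[rat]_n := [set a : 'M[rat]_n |
  [/\ forall i j, a i j \in [:: 0; 1; -1],
      forall i k : 'I_n, \sum_(j < n | (j <= k)%N) a i j \in [:: 0; 1],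
      forall j k : 'I_n, \sum_(i < n | (i <= k)%N) a i j \in [:: 0; 1],
      forall i, \sum_(j < n) a i j = 1
    & forall j, \sum_(i < n) a i j = 1]].

(* [rev_ord i : 'I_n.+1] has value n - i, and [ord_max : 'I_n.+1] value n. *)
Definition height_function (n : nat) : set 'M[rat]_n.+1 := [set h : 'M[rat]_n.+1 |
  [/\ forall (i : 'I_n) (j : 'I_n.+1), `|h (inord i.+1) j - h (inord i) j| = 1,
      forall (i : 'I_n.+1) (j : 'I_n), `|h i (inord j.+1) - h i (inord j)| = 1
    & forall i : 'I_n.+1,
        [/\ h i ord0 = i%:R, h ord0 i = i%:R,
            h (rev_ord i) ord_max = i%:R & h ord_max (rev_ord i) = i%:R]]].

(* With 0-based k, the range 1 <= k <= i becomes k < i. *)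
Definition height_of_asm (n : nat) (a : 'M[rat]_n) : 'M[rat]_n.+1 :=
  \matrix_(i < n.+1, j < n.+1)
    (i%:R + j%:R - 2 * \sum_(k < n | (k < i)%N) \sum_(l < n | (l < j)%N) a k l).

(* With 0-based i, the indices i - 1 and i of h become i and i + 1. *)
Definition asm_of_height (n : nat) (h : 'M[rat]_n.+1) : 'M[rat]_n :=
  \matrix_(i < n, j < n)
    (- (1 / 2) * (h (inord i) (inord j) - h (inord i) (inord j.+1)
                  + h (inord i.+1) (inord j.+1) - h (inord i.+1) (inord j))).

(* Main.v *)
Require Import Defs.
From mathcomp Require Import all_boot all_order all_algebra.
From mathcomp Require Import boolp classical_sets functions.
From mathcomp Require Import ring lra.

(** A height function is an affine function of the corner sums
    [c i j = \sum_(k < i) \sum_(l < j) a k l] of an ASM, so passing from [h]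
    to [a] is taking a mixed second difference, and passing back is summing it.
    The two maps are therefore mutually inverse for purely telescoping reasons:
    differencing undoes summing for every matrix ([height_of_asmK]), and summing
    undoes differencing as soon as [h] has the prescribed values on its first
    row and column ([asm_of_heightK]).

    What remains is that the two sets of conditions match.  Both directions
    rest on one identity: if [R i j] is the sum of the first [j] entries of row
    [i] of the ASM, then
      [h (i + 1) j - h i j = 1 - 2 * R i j]
    ([height_of_asm_step], [row_sum_asm_of_height]).  Hence vertical steps of
    [h] have absolute value 1 exactly when the partial row sums lie in
    [{0, 1}], and the last column of [h] is [n, n - 1, .., 0] exactly when the
    full row sums are 1.  An entry of [a] is a difference of two consecutive
    partial row sums, hence lies in [{0, 1, -1}].  All conditions on columns
    follow from those on rows, because both maps commute with transposition. *)

Import Order.TTheory GRing.Theory Num.Theory.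
Local Open Scope classical_set_scope.
Local Open Scope ring_scope.

Lemma sum_lt_ordS (V : nmodType) (n : nat) (F : 'I_n -> V) (k : 'I_n) :
  \sum_(j < n | (j < k.+1)%N) F j = \sum_(j < n | (j < k)%N) F j + F k.
Proof.
rewrite (bigD1 k) //= addrC; congr (_ + _).
by apply: eq_bigl => j; rewrite ltnS ltn_neqAle andbC.
Qed.

Lemma sum_lt_ord_full (V : nmodType) (n : nat) (F : 'I_n -> V) :
  \sum_(j < n | (j < n)%N) F j = \sum_(j < n) F j.
Proof. by apply: eq_bigl => j; rewrite ltn_ord. Qed.

Lemma telescope_sum_lt_ord (V : zmodType) (n m : nat) (f : nat -> V) :
  (m <= n)%N -> \sum_(j < n | (j < m)%N) (f j.+1 - f j) = f m - f 0.
Proof.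
move=> le_mn; rewrite -(big_ord_widen n (fun j => f j.+1 - f j)) //.
by rewrite -(big_mkord xpredT (fun j => f j.+1 - f j)) telescope_sumr.
Qed.

(** This turns the condition on the steps of a height function into the
    condition on the partial sums of an ASM. *)
Lemma norm_eq1_mem01 {R : realFieldType} {x y : R} :
  x = 1 - 2 * y -> (`|x| == 1) = (y \in [:: 0; 1]).
Proof.
move=> ->; rewrite eqr_norml ler01 andbT !inE.
by congr (_ || _); apply/eqP/eqP; lra.
Qed.

Lemma trmx_ASM {n : nat} {a : 'M[rat]_n} : ASM a -> ASM a^T.
Proof.
case=> a01 row01 col01 row1 col1; split=> [i j | i k | j k | i | j].
- by rewrite mxE.
- by under eq_bigr do rewrite mxE; apply: col01.
- by under eq_bigr do rewrite mxE; apply: row01.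
- by under eq_bigr do rewrite mxE; apply: col1.
- by under eq_bigr do rewrite mxE; apply: row1.
Qed.

Lemma trmx_height_of_asm {n : nat} (a : 'M[rat]_n) :
  (height_of_asm a)^T = height_of_asm a^T.
Proof.
apply/matrixP => i j; rewrite !mxE exchange_big [j%:R + _]addrC /=.
by under [in RHS]eq_bigr do under eq_bigr do rewrite mxE.
Qed.

Lemma trmx_height_function {n : nat} {h : 'M[rat]_n.+1} :
  height_function h -> height_function h^T.
Proof.
case=> vert horiz bnd; split=> [i j | i j | i].
- by rewrite !mxE.
- by rewrite !mxE.
- by rewrite !mxE; case: (bnd i).
Qed.

Lemma trmx_asm_of_height {n : nat} (h : 'M[rat]_n.+1) :
  (asm_of_height h)^T = asm_of_height h^T.
Proof. by apply/matrixP => i j; rewrite !mxE; ring. Qed.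

(** The corner sums of two consecutive rows differ by a partial row sum. *)
Lemma height_of_asm_step {n : nat} (a : 'M[rat]_n) (i : 'I_n) (j : 'I_n.+1) :
  height_of_asm a (inord i.+1) j - height_of_asm a (inord i) j
  = 1 - 2 * \sum_(l < n | (l < j)%N) a i l.
Proof.
have lt_i : (i.+1 < n.+1)%N := ltn_ord i.
by rewrite !mxE (inordK lt_i) (inordK (ltnW lt_i)) sum_lt_ordS -natr1; ring.
Qed.

(** An entry is the difference of two consecutive partial row sums, each of
    which is read off from a vertical step of the height matrix. *)
Lemma height_of_asmK (n : nat) : cancel (@height_of_asm n) (@asm_of_height n).
Proof.
move=> a; apply/matrixP => i j; rewrite mxE.
have lt_j : (j.+1 < n.+1)%N := ltn_ord j.
have := height_of_asm_step a i (inord j).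
have := height_of_asm_step a i (inord j.+1).
by rewrite (inordK lt_j) (inordK (ltnW lt_j)) sum_lt_ordS; lra.
Qed.

Lemma row_sum_ASM {n : nat} (a : 'M[rat]_n) (i : 'I_n) (j : 'I_n.+1) :
  ASM a -> \sum_(l < n | (l < j)%N) a i l \in [:: 0; 1].
Proof.
case=> _ row01 _ _ _; case: j => [[|k] lt_k] /=; first by rewrite big_pred0.
exact: (row01 i (Ordinal (lt_k : (k < n)%N))).
Qed.

Lemma height_of_asm_vert {n : nat} (a : 'M[rat]_n) (i : 'I_n) (j : 'I_n.+1) :
  ASM a -> `|height_of_asm a (inord i.+1) j - height_of_asm a (inord i) j| = 1.
Proof.
move=> Aa; apply/eqP.
by rewrite (norm_eq1_mem01 (height_of_asm_step a i j)) row_sum_ASM.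
Qed.

Lemma height_of_asm_col0 {n : nat} (a : 'M[rat]_n) (i : 'I_n.+1) :
  height_of_asm a i ord0 = i%:R.
Proof.
by rewrite mxE big1 => [|k _] /=; [ring | rewrite big_pred0].
Qed.

Lemma height_of_asm_col_max {n : nat} (a : 'M[rat]_n) (i : 'I_n.+1) :
  ASM a -> height_of_asm a (rev_ord i) ord_max = i%:R.
Proof.
case=> _ _ _ row1 _; rewrite mxE /= subSS.
have le_i : (i <= n)%N by rewrite -ltnS.
under eq_bigr do rewrite sum_lt_ord_full row1.
rewrite -(big_ord_widen n (fun=> 1)) ?leq_subr //.
by rewrite sumr_const card_ord natrB //; ring.
Qed.

Lemma height_of_asm_fun (n : nat) (a : 'M[rat]_n) :
  ASM a -> height_function (height_of_asm a).
Proof.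
move=> Aa; have Aat := trmx_ASM Aa.
have tr i j : height_of_asm a i j = height_of_asm a^T j i.
  by rewrite -trmx_height_of_asm [RHS]mxE.
split=> [i j | i j | i]; first exact: height_of_asm_vert.
- by rewrite !tr; apply: height_of_asm_vert.
- split; first exact: height_of_asm_col0.
  + by rewrite tr; apply: height_of_asm_col0.
  + exact: height_of_asm_col_max.
  + by rewrite tr; apply: height_of_asm_col_max.
Qed.

(** The mixed second difference is a horizontal difference of vertical steps,
    so its row sums telescope; the subtracted initial term is the vertical step
    in column 0, which is 1 because that column is [0, 1, .., n]. *)
Lemma row_sum_asm_of_height {n : nat} {h : 'M[rat]_n.+1} (i : 'I_n)
    (j : 'I_n.+1) :
  height_function h ->
  h (inord i.+1) j - h (inord i) j
  = 1 - 2 * \sum_(l < n | (l < j)%N) asm_of_height h i l.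
Proof.
case=> _ _ bnd; have lt_i : (i.+1 < n.+1)%N := ltn_ord i.
pose f k := - (1 / 2) * (h (inord i.+1) (inord k) - h (inord i) (inord k)).
have le_j : (j <= n)%N by rewrite -ltnS.
rewrite (eq_bigr (fun l : 'I_n => f l.+1 - f l)) => [|l _]; last first.
  by rewrite mxE /f; ring.
have inord0 : inord 0 = ord0 :> 'I_n.+1 by apply: val_inj; rewrite /= inordK.
have [hi _ _ _] := bnd (inord i); have [hi1 _ _ _] := bnd (inord i.+1).
rewrite telescope_sum_lt_ord // /f inord_val inord0 hi hi1.
by rewrite (inordK lt_i) (inordK (ltnW lt_i)) -natr1; field.
Qed.

Lemma row_sum_asm_of_height01 {n : nat} {h : 'M[rat]_n.+1} (i : 'I_n)
    (j : 'I_n.+1) :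
  height_function h ->
  \sum_(l < n | (l < j)%N) asm_of_height h i l \in [:: 0; 1].
Proof.
move=> Hh; rewrite -(norm_eq1_mem01 (row_sum_asm_of_height i j Hh)).
by case: Hh => -> _ _.
Qed.

Lemma row_psum_asm_of_height {n : nat} {h : 'M[rat]_n.+1} (i k : 'I_n) :
  height_function h ->
  \sum_(l < n | (l <= k)%N) asm_of_height h i l \in [:: 0; 1].
Proof. exact: (row_sum_asm_of_height01 i (lift ord0 k)). Qed.

(** The last column of [h] descends from [n] to [0], so its steps are all -1,
    which is the value of [1 - 2 * s] at [s = 1]. *)
Lemma row_total_asm_of_height {n : nat} {h : 'M[rat]_n.+1} (i : 'I_n) :
  height_function h -> \sum_(l < n) asm_of_height h i l = 1.
Proof.
move=> Hh; have := row_sum_asm_of_height i ord_max Hh.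
rewrite /= sum_lt_ord_full; have lt_i : (i.+1 < n.+1)%N := ltn_ord i.
case: Hh => _ _ bnd.
have last (k : 'I_n.+1) : h k ord_max = n%:R - k%:R.
  have [_ _ + _] := bnd (rev_ord k); rewrite rev_ordK => ->.
  by rewrite /= subSS natrB // -ltnS.
by rewrite !last (inordK lt_i) (inordK (ltnW lt_i)) -natr1; lra.
Qed.

(** Consecutive partial row sums both lie in [{0, 1}], so they differ by 0, 1
    or -1. *)
Lemma asm_of_height_mem {n : nat} {h : 'M[rat]_n.+1} (i j : 'I_n) :
  height_function h -> asm_of_height h i j \in [:: 0; 1; -1].
Proof.
move=> Hh; have := row_psum_asm_of_height i j Hh.
have := row_sum_asm_of_height01 i (widen_ord (leqnSn n) j) Hh.
rewrite [X in _ -> X \in _ -> _]sum_lt_ordS /=.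
set s := \sum_(_ < n | _) _; set x := asm_of_height h i j.
by rewrite !inE => /orP[]/eqP-> /orP[]/eqP E; apply/or3P;
  [constructor 1 | constructor 2 | constructor 3 | constructor 1];
  apply/eqP; lra.
Qed.

Lemma asm_of_height_fun (n : nat) (h : 'M[rat]_n.+1) :
  height_function h -> ASM (asm_of_height h).
Proof.
move=> Hh; have Hht := trmx_height_function Hh.
have tr i j : asm_of_height h i j = asm_of_height h^T j i.
  by rewrite -trmx_asm_of_height [RHS]mxE.
split=> [i j | i k | j k | i | j].
- exact: asm_of_height_mem.
- exact: row_psum_asm_of_height.
- by under eq_bigr do rewrite tr; apply: row_psum_asm_of_height.
- exact: row_total_asm_of_height.
- by under eq_bigr do rewrite tr; apply: row_total_asm_of_height.
Qed.

(** Summing the row identity over the rows above [i] telescopes vertically to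
    [h i j - h 0 j = i - 2 * c i j], where [c] is the corner sum; the first row
    of [h] supplies the missing [h 0 j = j]. *)
Lemma asm_of_heightK (n : nat) (h : 'M[rat]_n.+1) :
  height_function h -> height_of_asm (asm_of_height h) = h.
Proof.
move=> Hh; apply/matrixP => i j; rewrite mxE.
have le_i : (i <= n)%N by rewrite -ltnS.
pose f k := (k%:R - h (inord k) j) / 2.
rewrite (eq_bigr (fun k : 'I_n => f k.+1 - f k)) => [|k _]; last first.
  by have := row_sum_asm_of_height k j Hh; rewrite /f -[k.+1%:R]natr1; lra.
have inord0 : inord 0 = ord0 :> 'I_n.+1 by apply: val_inj; rewrite /= inordK.
case: Hh => _ _ /(_ j)[_ h0j _ _].
by rewrite telescope_sum_lt_ord // /f inord_val inord0 h0j; field.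
Qed.

Theorem proposition3p2 (n : nat) (n_gt0 : (0 < n)%N) :
  [/\ set_bij (@ASM n) (@height_function n) (@height_of_asm n),
      set_fun (@height_function n) (@ASM n) (@asm_of_height n),
      {in @ASM n, cancel (@height_of_asm n) (@asm_of_height n)}
    & {in @height_function n, cancel (@asm_of_height n) (@height_of_asm n)}].
Proof.
split.
- split.
  + exact: height_of_asm_fun.
  + by move=> a b _ _; apply: (can_inj (@height_of_asmK n)).
  + move=> h Hh; exists (asm_of_height h); first exact: asm_of_height_fun.
    exact: asm_of_heightK.
- exact: asm_of_height_fun.
- by move=> a _; apply: height_of_asmK.
- by move=> h /[!inE]; apply: asm_of_heightK.
Qed.
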